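(* Assume that for every $\lambda\in\mathbb{R}^m$ the point $\bar z(\lambda)\in Z$ satisfies $$\min_{z\in Z}\langle \nabla\mathcal{L}_\rho(\bar z(\lambda),\lambda),\, z-\bar z(\lambda)\rangle \ge -\left(1+\sqrt{2L_{\mathrm p}}\,R_{\mathrm p}\right)\varepsilon_{\mathrm{in}} .$$ Let $(\lambda_k)_{k\ge0}$ be generated from $\lambda_0\in\mathbb{R}^m$ by $$\lambda_{k+1}=\lambda_k+\alpha_k\nabla\bar d_\rho(\lambda_k),\qquad \alpha_k\in[\underline L^{-1},L_{\mathrm d}^{-1}],$$ and let $S_k=\sum_{j=0}^k\alpha_j$, $\bar z_j=\bar z(\lambda_j)$ and $\hat z_k=S_k^{-1}\sum_{j=0}^k\alpha_j\bar z_j$. Then for every $k\ge1$ $$-\left[\|\lambda^*\|+\frac\rho2\,\nu(k,\varepsilon_{\mathrm{in}})\right]\nu(k,\varepsilon_{\mathrm{in}})\ \le\ f(\hat z_k)-f^*\ \le\ \frac{\underline L\|\lambda_0\|^2}{2(k+1)}+\left(1+\sqrt{2L_{\mathrm p}}\,R_{\mathrm p}\right)\varepsilon_{\mathrm{in}},$$ where $$\nu(k,\varepsilon_{\mathrm{in}}):=\frac{2\underline L R_{\mathrm d}}{k+1}+\sqrt{\frac{2\underline L\left(1+\sqrt{2L_{\mathrm p}}\,R_{\mathrm p}\right)\varepsilon_{\mathrm{in}}}{k+1}},\qquad R_{\mathrm d}=\|\lambda_0-\lambda^*\|.$$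
   Context: Setting: $f:\mathbb{R}^n\to\mathbb{R}$ is convex and differentiable, $A\in\mathbb{R}^{m\times n}$ has full row rank, $b\in\mathbb{R}^m$, $Z\subset\mathbb{R}^n$ is nonempty, compact and convex, $\rho>0$, $\varepsilon_{\mathrm{in}}>0$; $\|\cdot\|$ and $\langle\cdot,\cdot\rangle$ are the Euclidean norm and inner product. Primal problem: $f^*=\min\{f(z): Az=b,\ z\in Z\}$. Augmented Lagrangian: $\mathcal{L}_\rho(z,\lambda)=f(z)+\langle\lambda,Az-b\rangle+\frac\rho2\|Az-b\|^2$; $\nabla\mathcal{L}_\rho$ denotes its gradient in $z$, assumed Lipschitz continuous in $z$ on $\mathbb{R}^n$ with constant $L_{\mathrm p}>0$ for each $\lambda$. $R_{\mathrm p}=\max_{z,y\in Z}\|z-y\|$. Augmented dual function: $d_\rho(\lambda)=\min_{z\in Z}\mathcal{L}_\rho(z,\lambda)$. Slater's constraint qualification is assumed, so that $f^*=\max_{\lambda}\min_{z\in Z}\{f(z)+\langle\lambda,Az-b\rangle\}$; $\lambda^*$ denotes a maximizer of this dual problem (the ordinary dual and the problem $\max_\lambda d_\rho(\lambda)$ have the same optimal value and the same optimal solutions). $L_{\mathrm d}=1/\rho$ and $\underline L\ge L_{\mathrm d}$ is a fixed constant. Inexact dual information: for each $\lambda$ an approximate minimizer $\bar z(\lambda)\in Z$ of $\mathcal{L}_\rho(\cdot,\lambda)$ over $Z$ is fixed, and $\nabla\bar d_\rho(\lambda):=A\bar z(\lambda)-b$ (a notation, not necessarily a gradient). *)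

(* Defs.v *)
From HB Require Import structures.
From mathcomp Require Import all_boot all_order all_algebra.
From mathcomp Require Import all_classical all_reals all_analysis.
Set Implicit Arguments.
Unset Strict Implicit.
Unset Printing Implicit Defensive.
Import Order.TTheory GRing.Theory Num.Theory.
Import numFieldNormedType.Exports.
Local Open Scope classical_set_scope.
Local Open Scope ring_scope.

(* The library norm `|x| on 'cV[R]_n is the sup norm. It induces the usual
   topology of R^n, so compactness and differentiability are taken from the
   library, but every metric quantity below uses the Euclidean norm [enorm]. *)
Definition inner (R : realType) (n : nat) (x y : 'cV[R]_n) : R :=
  \sum_(i < n) x i 0 * y i 0.

Definition enorm (R : realType) (n : nat) (x : 'cV[R]_n) : R :=
  Num.sqrt (inner x x).

Definition grad (R : realType) (n : nat) (g : 'cV[R]_n -> R) (z : 'cV[R]_n) :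
    'cV[R]_n :=
  \col_(i < n) 'D_(delta_mx i 0) g z.

(* [inf] is used for min, and [sup] for max in [diameter]: the sets involved
   are images, under continuous functions, of nonempty compact sets, so the
   extrema are attained. *)
Definition min_over (T : Type) (R : realType) (g : T -> R) (S : set T) : R :=
  inf [set g x | x in S].

Definition diameter (R : realType) (n : nat) (Z : set 'cV[R]_n) : R :=
  sup [set r | exists z y, [/\ Z z, Z y & r = enorm (z - y)]].

Definition affine_hull (R : realType) (n : nat) (S : set 'cV[R]_n) :
    set 'cV[R]_n :=
  [set x | exists (k : nat) (c : 'I_k -> R) (p : 'I_k -> 'cV[R]_n),
     [/\ forall i, S (p i), \sum_(i < k) c i = 1
       & x = \sum_(i < k) c i *: p i]].

Definition relint (R : realType) (n : nat) (S : set 'cV[R]_n) :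
    set 'cV[R]_n :=
  [set x | S x /\ \forall y \near x, affine_hull S y -> S y].

Definition slater (R : realType) (m n : nat) (A : 'M[R]_(m, n)) (b : 'cV[R]_m)
    (Z : set 'cV[R]_n) : Prop :=
  exists2 z, relint Z z & A *m z = b.

Definition primal_value (R : realType) (m n : nat) (f : 'cV[R]_n -> R)
    (A : 'M[R]_(m, n)) (b : 'cV[R]_m) (Z : set 'cV[R]_n) : R :=
  min_over f [set z | A *m z = b /\ Z z].

Definition lagrangian (R : realType) (m n : nat) (f : 'cV[R]_n -> R)
    (A : 'M[R]_(m, n)) (b : 'cV[R]_m) (z : 'cV[R]_n) (lambda : 'cV[R]_m) : R :=
  f z + inner lambda (A *m z - b).

Definition dual_function (R : realType) (m n : nat) (f : 'cV[R]_n -> R)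
    (A : 'M[R]_(m, n)) (b : 'cV[R]_m) (Z : set 'cV[R]_n)
    (lambda : 'cV[R]_m) : R :=
  min_over (fun z => lagrangian f A b z lambda) Z.

Definition dual_solution (R : realType) (m n : nat) (f : 'cV[R]_n -> R)
    (A : 'M[R]_(m, n)) (b : 'cV[R]_m) (Z : set 'cV[R]_n)
    (lambda : 'cV[R]_m) : Prop :=
  forall mu, dual_function f A b Z mu <= dual_function f A b Z lambda.

Definition aug_lagrangian (R : realType) (m n : nat) (f : 'cV[R]_n -> R)
    (A : 'M[R]_(m, n)) (b : 'cV[R]_m) (rho : R) (z : 'cV[R]_n)
    (lambda : 'cV[R]_m) : R :=
  lagrangian f A b z lambda + rho / 2 * enorm (A *m z - b) ^+ 2.

Definition grad_aug_lagrangian (R : realType) (m n : nat) (f : 'cV[R]_n -> R)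
    (A : 'M[R]_(m, n)) (b : 'cV[R]_m) (rho : R) (z : 'cV[R]_n)
    (lambda : 'cV[R]_m) : 'cV[R]_n :=
  grad (fun x => aug_lagrangian f A b rho x lambda) z.

Definition inexact_dual_grad (R : realType) (m n : nat) (A : 'M[R]_(m, n))
    (b : 'cV[R]_m) (zbar : 'cV[R]_m -> 'cV[R]_n) (lambda : 'cV[R]_m) :
    'cV[R]_m :=
  A *m zbar lambda - b.

(* Main.v *)
Require Import Defs.
From HB Require Import structures.
From mathcomp Require Import all_boot all_order all_algebra.
From mathcomp Require Import all_classical all_reals all_analysis.
From mathcomp Require Import ring lra.
Import Order.TTheory GRing.Theory Num.Theory.
Import numFieldNormedType.Exports.
Local Open Scope classical_set_scope.
Local Open Scope ring_scope.

(* Testing the approximate stationarity of zbar(lambda_j) against a feasible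
   point and using convexity of f gives
     f(zbar_j) + <lambda_j, r_j> + rho |r_j|^2 - delta <= f*,  r_j = A zbar_j - b.
   Since alpha_j <= rho, this turns into
     |lambda_(j+1) - mu|^2 <= |lambda_j - mu|^2 + 2 alpha_j e_j
   with e_j = f* - f(zbar_j) + delta for mu = 0, and, by strong duality, with
   e_j = delta for mu = lambda*. Summing the first and applying Jensen yields the
   upper bound; summing the second bounds A zhat_k - b, which equals
   (lambda_(k+1) - lambda_0) / S_k, and duality then gives the lower bound.
   As lambda* is a given dual maximizer, only the absence of a duality gap is
   needed; it follows from compactness of Z by a quadratic penalty argument. *)

(** * Euclidean inner product, norm and gradient *)

Section EuclideanSpace.
Context {R : realType} {n : nat}.
Implicit Types (x y z : 'cV[R]_n) (a : R).

Lemma innerC x y : inner x y = inner y x.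
Proof. by apply: eq_bigr => i _; rewrite mulrC. Qed.

Lemma innerDl x y z : inner (x + y) z = inner x z + inner y z.
Proof. by rewrite -big_split; apply: eq_bigr => i _; rewrite mxE mulrDl. Qed.

Lemma innerZl a x y : inner (a *: x) y = a * inner x y.
Proof. by rewrite /inner mulr_sumr; apply: eq_bigr => i _; rewrite mxE mulrA. Qed.

Lemma innerDr x y z : inner x (y + z) = inner x y + inner x z.
Proof. by rewrite innerC innerDl !(innerC x). Qed.

Lemma innerZr a x y : inner x (a *: y) = a * inner x y.
Proof. by rewrite innerC innerZl innerC. Qed.

Lemma innerNl x y : inner (- x) y = - inner x y.
Proof. by rewrite -scaleN1r innerZl mulN1r. Qed.

Lemma innerNr x y : inner x (- y) = - inner x y.
Proof. by rewrite innerC innerNl innerC. Qed.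

Definition innerE :=
  (innerDl, innerDr, innerZl, innerZr, innerNl, innerNr).

Lemma inner0l x : inner 0 x = 0.
Proof. by rewrite -(scale0r 0) innerZl mul0r. Qed.

Lemma inner_ge0 x : 0 <= inner x x.
Proof. by apply: sumr_ge0 => i _; rewrite -expr2 sqr_ge0. Qed.

Lemma enorm_ge0 x : 0 <= enorm x.
Proof. exact: sqrtr_ge0. Qed.

Lemma sqr_enorm x : enorm x ^+ 2 = inner x x.
Proof. exact/sqr_sqrtr/inner_ge0. Qed.

Lemma enormN x : enorm (- x) = enorm x.
Proof. by rewrite /enorm !innerE opprK. Qed.

Lemma enormZ a x : 0 <= a -> enorm (a *: x) = a * enorm x.
Proof.
by move=> a0; rewrite /enorm !innerE mulrA -expr2 sqrtrM ?sqr_ge0// sqrtr_sqr ger0_norm.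
Qed.

Lemma inner_eq0 x : inner x x = 0 -> x = 0.
Proof.
move/eqP; rewrite psumr_eq0 => [/allP x0|i _]; last by rewrite -expr2 sqr_ge0.
apply/colP => i; have := x0 i (mem_index_enum i).
by rewrite /= mulf_eq0 orbb mxE => /eqP.
Qed.

Lemma enorm_eq0 x : enorm x = 0 -> x = 0.
Proof. by move=> x0; apply: inner_eq0; rewrite -sqr_enorm x0 expr0n. Qed.

(** Cauchy-Schwarz: expanding the squared norm of [enorm y *: x - enorm x *: y] leaves 2|x||y|
    (|x||y| - <x,y>) >= 0, and the factor |x||y| cancels once zero vectors are set aside. *)
Lemma inner_le_enorm x y : inner x y <= enorm x * enorm y.
Proof.
have [/enorm_eq0 ->|x0] := eqVneq (enorm x) 0.
  by rewrite inner0l mulr_ge0 ?enorm_ge0.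
have [/enorm_eq0 ->|y0] := eqVneq (enorm y) 0.
  by rewrite innerC inner0l mulr_ge0 ?enorm_ge0.
have xy_gt0 : 0 < enorm x * enorm y.
  by rewrite mulr_gt0// lt_neqAle eq_sym ?x0 ?y0 enorm_ge0.
rewrite -(ler_pM2l xy_gt0) -subr_ge0.
have := inner_ge0 (enorm y *: x - enorm x *: y).
rewrite !innerE (innerC y x) -!sqr_enorm; lra.
Qed.

Lemma enormD x y : enorm (x + y) <= enorm x + enorm y.
Proof.
rewrite -ler_sqr ?nnegrE ?addr_ge0 ?enorm_ge0// sqr_enorm !innerE (innerC y x).
rewrite -!sqr_enorm; have := inner_le_enorm x y; lra.
Qed.

(** The differential is linear, so expanding [y] in the standard basis recovers its value from the
    partial derivatives. *)
Lemma inner_grad (g : 'cV[R]_n -> R) x y :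
  differentiable g x -> inner (grad g x) y = 'D_y g x.
Proof.
move=> dg; rewrite [in RHS](matrix_sum_delta y) deriveE// linear_sum.
apply: eq_bigr => i _; rewrite big_ord1 linearZ mxE deriveE//.
exact: mulrC.
Qed.

Lemma differentiable_inner (V : normedModType R) (g h : V -> 'cV[R]_n) v :
  (forall i, differentiable (fun w => g w i 0 : R) v) ->
  (forall i, differentiable (fun w => h w i 0 : R) v) ->
  differentiable (fun w => inner (g w) (h w)) v.
Proof.
move=> dg dh.
rewrite (_ : (fun w => _) = \sum_(i < n) ((fun w => g w i 0) * (fun w => h w i 0))).
  by apply: differentiable_sum => i; exact: differentiableM.
by apply/funext => w; rewrite fct_sumE.
Qed.

End EuclideanSpace.

(** * Convexity with a real coefficient in [0, 1] *)

Section Convexity.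
Context {R : realType} {V : lmodType R}.

Lemma convex_setP (C : set V) (t : R) (x y : V) :
  convex_set C -> 0 <= t <= 1 -> C x -> C y -> C (t *: x + (1 - t) *: y).
Proof.
move=> cC t01 Cx Cy.
have := cC x y (@Itv01 R t (andP t01).1 (andP t01).2) (mem_set Cx) (mem_set Cy).
by move/set_mem.
Qed.

Lemma convex_functionP (f : V -> R) (t : R) (x y : V) :
  convex_function [set: V] f -> 0 <= t <= 1 ->
  f (t *: x + (1 - t) *: y) <= t * f x + (1 - t) * f y.
Proof.
move=> cf t01.
exact: (cf (@Itv01 R t (andP t01).1 (andP t01).2) x y (in_setT x) (in_setT y)).
Qed.

End Convexity.

(** * Weighted averages and Jensen's inequality *)

Section WeightedAverage.
Context {R : realType}.

(** Taken over any module, so that points and, through [R^o], function values are averaged alike. *)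
Definition weighted_average {V : lmodType R} (a : nat -> R) (z : nat -> V)
    (k : nat) : V :=
  (\sum_(0 <= j < k.+1) a j)^-1 *: \sum_(0 <= j < k.+1) a j *: z j.

Variable a : nat -> R.
Hypothesis a_gt0 : forall j, 0 < a j.

Lemma weight_sum_gt0 k : 0 < \sum_(0 <= j < k.+1) a j.
Proof.
by rewrite big_nat_recr//= ltr_wpDl// sumr_ge0// => j _; exact/ltW/a_gt0.
Qed.

Let ratio k := (\sum_(0 <= j < k.+1) a j) / \sum_(0 <= j < k.+2) a j.

Let ratio01 k : 0 <= ratio k <= 1.
Proof.
rewrite divr_ge0 ?(ltW (weight_sum_gt0 _))//= ler_pdivrMr ?weight_sum_gt0//.
by rewrite mul1r [leRHS]big_nat_recr//= lerDl ltW.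
Qed.

(** Each new point enters by a two-point convex combination, so binary convexity passes to averages
    by induction. *)
Lemma weighted_average_recr (V : lmodType R) (z : nat -> V) k :
  weighted_average a z k.+1 =
  ratio k *: weighted_average a z k + (1 - ratio k) *: z k.+1.
Proof.
have S0 := weight_sum_gt0 k; have S1 := weight_sum_gt0 k.+1.
rewrite /weighted_average scalerA mulrAC divff ?gt_eqF// mul1r.
rewrite -(divff (lt0r_neq0 S1)) -mulrBl [in X in (X - _) / _]big_nat_recr//=.
rewrite addrAC subrr add0r (big_nat_recr k.+1 0 (fun j => a j *: z j))//=.
by rewrite scalerDr scalerA (mulrC _^-1 (a _)).
Qed.

Lemma weighted_average0 (V : lmodType R) (z : nat -> V) :
  weighted_average a z 0 = z 0%N.
Proof.
by rewrite /weighted_average !big_nat1 scalerA mulVf ?scale1r// gt_eqF.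
Qed.

Lemma convex_set_average (V : lmodType R) (C : set V) (z : nat -> V) k :
  convex_set C -> (forall j, C (z j)) -> C (weighted_average a z k).
Proof.
move=> cC Cz; elim: k => [|k IH]; first by rewrite weighted_average0.
by rewrite weighted_average_recr; exact: convex_setP.
Qed.

Lemma convex_function_average (V : lmodType R) (f : V -> R) (z : nat -> V) k :
  convex_function [set: V] f ->
  f (weighted_average a z k) <= weighted_average a (f \o z : nat -> R^o) k.
Proof.
move=> cf; elim: k => [|k IH]; first by rewrite !weighted_average0.
rewrite !weighted_average_recr; apply: le_trans (convex_functionP _ _ _ _ cf _) _ => //.
by rewrite lerD2r ler_wpM2l//; case/andP: (ratio01 k).
Qed.

End WeightedAverage.

(** * Minima on compact sets and penalization *)

Section Minimum.
Context {R : realType} {T : topologicalType}.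
Implicit Types (g h : T -> R) (Z : set T).

Lemma compact_min g Z : Z !=set0 -> compact Z -> continuous g ->
  exists2 x, Z x & forall y, Z y -> g x <= g y.
Proof.
move=> Z0 cZ cg; have [x /set_mem Zx xmin] :=
  compact_EVT_min Z0 cZ (continuous_subspaceT cg).
by exists x => // y /mem_set; exact: xmin.
Qed.

Lemma min_over_le g Z x : compact Z -> continuous g -> Z x ->
  min_over g Z <= g x.
Proof.
move=> cZ cg Zx; apply: ge_inf; last by exists x.
have [y _ ymin] := compact_min g Z (ex_intro _ x Zx) cZ cg.
by exists (g y) => _ [z Zz <-]; exact: ymin.
Qed.

Lemma le_min_over g Z a : Z !=set0 -> (forall x, Z x -> a <= g x) ->
  a <= min_over g Z.
Proof.
move=> [x Zx] aZ; apply: lb_le_inf; first by exists (g x), x.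
by move=> _ [y Zy <-]; exact: aZ.
Qed.

(** On the compact set [K] where [g <= v - e], [h] cannot vanish, so its minimum [h p] is positive;
    [c] is chosen so that [c * h p] makes up for the worst deficit [v - g q]. Off [K] any
    nonnegative [c] works. *)
Lemma penalty_approximation g h Z v e : compact Z -> continuous g ->
    continuous h -> (forall x, 0 <= h x) ->
    (forall x, Z x -> h x = 0 -> v <= g x) -> 0 < e ->
  exists2 c, 0 <= c & forall x, Z x -> v - e <= g x + c * h x.
Proof.
move=> cZ cg ch h0 vg e0; pose K := Z `&` [set x | g x <= v - e].
have cK : compact K.
  apply: compact_closedI => //.
  by apply: (@closed_comp _ _ g [set r | r <= v - e]) => [x _|]; [exact: cg|exact: closed_le].
have [K0|/set0P/negP/negPn/eqP K0] := pselect (K !=set0); last first.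
  exists 0 => // x Zx; rewrite mul0r addr0 leNgt; apply/negP => /ltW gx.
  by have : K x by []; rewrite K0.
have [p [Zp gp] pmin] := compact_min h K K0 cK ch.
have [q [Zq gq] qmin] := compact_min g K K0 cK cg.
have hp0 : 0 < h p.
  rewrite lt_neqAle h0 andbT; apply/eqP => /esym /(vg _ Zp) /=.
  by move: gp => /=; lra.
have vq : 0 <= v - g q by move: gq => /=; lra.
exists ((v - g q) / h p); first by rewrite divr_ge0// ltW.
move=> x Zx; have [gx|gx] := leP (g x) (v - e); last first.
  by rewrite (le_trans (ltW gx))// lerDl mulr_ge0// divr_ge0// ltW.
have Kx : K x by [].
have : v - g q <= (v - g q) / h p * h x.
  by rewrite mulrAC ler_pdivlMr// ler_wpM2l// pmin.
have := qmin x Kx; lra.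
Qed.

End Minimum.

(** Replaces a limit t -> 0: if d < 0, then t = -d / (e - d) gives d + t e = -d^2 / (e - d) < 0. *)
Lemma ge0_of_small_perturbation {R : realFieldType} (d e : R) : 0 <= e ->
  (forall t, 0 < t <= 1 -> 0 <= d + t * e) -> 0 <= d.
Proof.
move=> e0 dte; rewrite leNgt; apply/negP => d0.
have ed : 0 < e - d by lra.
have t01 : 0 < - d / (e - d) <= 1.
  by rewrite divr_gt0 ?oppr_gt0//= ler_pdivrMr// mul1r; lra.
have := dte _ t01.
rewrite (_ : d + _ = - (d * d) / (e - d)); last by field; rewrite gt_eqF.
by rewrite leNgt => /negP; apply; rewrite pmulr_llt0 ?invr_gt0// oppr_lt0 nmulr_rgt0.
Qed.

(** * Augmented Lagrangian, approximate stationarity and strong duality *)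

Section AugmentedLagrangian.
Context {R : realType} {m n : nat}.
Variables (f : 'cV[R]_n -> R) (A : 'M[R]_(m, n)) (b : 'cV[R]_m).
Variable Z : set 'cV[R]_n.
Hypothesis f_convex : convex_function [set: 'cV[R]_n] f.
Hypothesis f_diff : forall z, differentiable f z.
Hypothesis Z_compact : compact Z.
Hypothesis Z_convex : convex_set Z.

Local Notation res z := (A *m z - b).

Lemma differentiable_residual z i :
  differentiable (fun w : 'cV[R]_n => (A *m w - b) i 0 : R) z.
Proof.
rewrite (_ : (fun w => _) =
    \sum_(j < n) (cst (A i j) * (fun w : 'cV[R]_n => w j 0 : R)) + cst (- b i 0)).
  apply: differentiableD; last exact: differentiable_cst.
  apply: differentiable_sum => j; apply: differentiableM.
    exact: differentiable_cst.
  exact: differentiable_coord.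
by apply/funext => w; rewrite !mxE [in RHS]/+%R /= fct_sumE.
Qed.

Lemma differentiable_lagrangian lambda z :
  differentiable (fun w => lagrangian f A b w lambda) z.
Proof.
apply: differentiableD => //; apply: differentiable_inner => i.
  exact: differentiable_cst.
exact: differentiable_residual.
Qed.

Lemma differentiable_sqr_residual z :
  differentiable (fun w => enorm (res w) ^+ 2) z.
Proof.
under eq_fun do rewrite sqr_enorm.
by apply: differentiable_inner => i; exact: differentiable_residual.
Qed.

Lemma differentiable_aug_lagrangian rho lambda z :
  differentiable (fun w => aug_lagrangian f A b rho w lambda) z.
Proof.
apply: differentiableD; first exact: differentiable_lagrangian.
apply: (differentiableM (f := cst (rho / 2))); first exact: differentiable_cst.
exact: differentiable_sqr_residual.
Qed.

Lemma residual_segment t x z :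
  A *m (t *: z + (1 - t) *: x) - b = res x + t *: (res z - res x).
Proof.
rewrite mulmxDr -!scalemxAr; apply/colP => i; rewrite !mxE; ring.
Qed.

(** Convexity bounds [f]; the remaining terms are expanded exactly. The penalty shifts the
    multiplier to [lambda + rho *: res x] at first order and leaves a remainder in t^2. *)
Lemma aug_lagrangian_segment rho lambda t x z : 0 <= t <= 1 ->
  aug_lagrangian f A b rho (t *: z + (1 - t) *: x) lambda <=
  aug_lagrangian f A b rho x lambda +
  t * (f z - f x + inner (lambda + rho *: res x) (res z - res x)) +
  t ^+ 2 * (rho / 2 * enorm (res z - res x) ^+ 2).
Proof.
move=> t01; rewrite /aug_lagrangian /lagrangian residual_segment !sqr_enorm.
have := convex_functionP f t z x f_convex t01.
set w := res z - res x; move: (res x) w => r w.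
rewrite !innerE (innerC w r); lra.
Qed.

(** Divide the segment estimate by t and let t -> 0+; the quadratic remainder disappears. *)
Lemma grad_aug_lagrangian_le rho lambda x z :
  inner (grad_aug_lagrangian f A b rho x lambda) (z - x) <=
  f z - f x + inner (lambda + rho *: res x) (res z - res x).
Proof.
rewrite inner_grad; last exact: differentiable_aug_lagrangian.
set G := fun w => _; set B := (X in _ <= X).
pose E := rho / 2 * enorm (res z - res x) ^+ 2.
have dG : derivable G x (z - x).
  exact/diff_derivable/differentiable_aug_lagrangian.
have cE : (fun t => B + t * E) t @[t --> 0^'+] --> B.
  apply: cvg_at_right_filter.
  have -> : nbhs B = nbhs (B + 0 * E) by rewrite mul0r addr0.
  by apply: cvgD; [exact: cvg_cst|apply: cvgM; [exact: cvg_id|exact: cvg_cst]].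
apply: ler_cvg_to (cvg_dnbhs_at_right dG) cE _.
near=> t.
have t0 : 0 < t by near: t; exact: nbhs_right_gt.
have t1 : t <= 1 by near: t; exact: nbhs_right_le.
rewrite /= [leLHS]mulrC ler_pdivrMr// lerBlDl.
rewrite (_ : t *: (z - x) + x = t *: z + (1 - t) *: x); last first.
  by apply/colP => i; rewrite !mxE; ring.
rewrite (le_trans (aug_lagrangian_segment _ _ _ _ _ _)) ?(ltW t0)//.
by rewrite -/B -/E -/(G x); lra.
Unshelve. all: by end_near. Qed.

Lemma approximate_stationarity rho lambda delta x : Z x ->
  - delta <= min_over (fun z =>
     inner (grad_aug_lagrangian f A b rho x lambda) (z - x)) Z ->
  forall z, Z z ->
  f x + inner (lambda + rho *: res x) (res x) - delta <=
  f z + inner (lambda + rho *: res x) (res z).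
Proof.
move=> Zx dmin z Zz; set g := grad_aug_lagrangian _ _ _ _ _ _ in dmin.
have cg : continuous (fun w : 'cV[R]_n => inner g (w - x)).
  move=> w; apply: differentiable_continuous.
  apply: differentiable_inner => i; first exact: differentiable_cst.
  rewrite (_ : (fun w => _) = (fun w : 'cV[R]_n => w i 0 : R) + cst (- x i 0)).
    apply: differentiableD; last exact: differentiable_cst.
    exact: differentiable_coord.
  by apply/funext => w'; rewrite !mxE.
have := le_trans dmin (min_over_le _ _ z Z_compact cg Zz).
have := grad_aug_lagrangian_le rho lambda x z; rewrite -/g.
rewrite [X in _ <= _ + X]innerDr innerNr; lra.
Qed.

Hypothesis feasible : [set z | A *m z = b /\ Z z] !=set0.

Lemma continuous_f : continuous f.
Proof. by move=> z; exact: differentiable_continuous. Qed.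

Lemma primal_value_le z : A *m z = b -> Z z -> primal_value f A b Z <= f z.
Proof.
move=> Az Zz; apply: min_over_le => //; last exact: continuous_f.
(* The feasible set is [Z] cut by a closed sublevel set, hence compact. *)
rewrite (_ : mkset _ = Z `&` (fun w => enorm (res w) ^+ 2) @^-1` [set r | r <= 0]).
  apply: compact_closedI => //; apply: closed_comp => [w _|]; last exact: closed_le.
  exact/differentiable_continuous/differentiable_sqr_residual.
apply/seteqP; split => w /=.
  by move=> [Aw Zw]; rewrite Aw subrr sqr_enorm inner0l.
move=> [Zw]; rewrite sqr_enorm => rw0; split => //; apply/eqP; rewrite -subr_eq0.
by apply/eqP/inner_eq0/eqP; rewrite eq_le rw0 inner_ge0.
Qed.

(** Feasible points have zero residual, so the multiplier term vanishes at them. *)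
Lemma stationarity_value_le rho lambda delta x : Z x ->
  - delta <= min_over (fun z =>
     inner (grad_aug_lagrangian f A b rho x lambda) (z - x)) Z ->
  f x + inner (lambda + rho *: res x) (res x) - delta <= primal_value f A b Z.
Proof.
move=> Zx dmin; apply: le_min_over => // z [Az Zz].
rewrite (le_trans (approximate_stationarity _ _ _ _ Zx dmin _ Zz))//.
by rewrite Az subrr innerC inner0l addr0.
Qed.

(* The multiplier is 2c(Az - b) for a minimizer z of f + c|A. - b|^2 over Z:
   first-order optimality makes z a minimizer of the ordinary Lagrangian. *)
Lemma approximate_strong_duality e : 0 < e ->
  exists mu, primal_value f A b Z - e <= dual_function f A b Z mu.
Proof.
move=> e0; have Z0 : Z !=set0 by case: feasible => z [_ Zz]; exists z.
have cr : continuous (fun w => enorm (res w) ^+ 2).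
  by move=> w; exact/differentiable_continuous/differentiable_sqr_residual.
have [||c c0 cP] := penalty_approximation f (fun w => enorm (res w) ^+ 2) Z
    (primal_value f A b Z) e Z_compact continuous_f cr _ _ e0.
- by move=> w; rewrite sqr_ge0.
- move=> w Zw; rewrite sqr_enorm => /inner_eq0/eqP.
  by rewrite subr_eq0 => /eqP Aw; exact: primal_value_le.
(* The parameter [2 * c] offsets the factor 1/2 in the augmented Lagrangian, so [G] is f + c|A. -
   b|^2. *)
pose G w := aug_lagrangian f A b (2 * c) w 0.
have cG : continuous G.
  by move=> w; exact/differentiable_continuous/differentiable_aug_lagrangian.
have [x Zx xmin] := compact_min G Z Z0 Z_compact cG.
exists ((2 * c) *: res x); apply: le_min_over => // z Zz.
rewrite /lagrangian; have := cP x Zx.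
(* This gives the Lagrangian at [z] at least f(x) + 2c|res x|^2, which dominates the penalized value
   at [x]. *)
suff : 0 <= f z - f x + inner (0 + (2 * c) *: res x) (res z - res x).
  rewrite add0r innerDr innerNr !innerZl -sqr_enorm.
  have := mulr_ge0 c0 (sqr_ge0 (enorm (res x))); lra.
(* Minimality of [x] along the segment towards [z], divided by t, leaves the perturbation t c|res z
   - res x|^2. *)
apply: (@ge0_of_small_perturbation _ _ (c * enorm (res z - res x) ^+ 2)).
  by rewrite mulr_ge0 ?sqr_ge0.
move=> t /andP[t0 t1]; rewrite -(pmulr_rge0 _ t0).
have t01 : 0 <= t <= 1 by rewrite ltW.
have := aug_lagrangian_segment (2 * c) 0 t x z t01.
have := xmin _ (convex_setP _ _ _ _ Z_convex t01 Zz Zx).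
rewrite /G (_ : 2 * c / 2 = c); last by field.
lra.
Qed.

(** A dual maximizer does at least as well as every approximate multiplier, so the gap is below
    every e > 0. *)
Lemma dual_solution_lower_bound lambda z : dual_solution f A b Z lambda ->
  Z z -> primal_value f A b Z <= lagrangian f A b z lambda.
Proof.
move=> opt Zz; apply/ler_addgt0Pr => e e0.
have [mu muP] := approximate_strong_duality e e0.
rewrite -lerBlDr (le_trans muP)// (le_trans (opt mu))//.
apply: (min_over_le (fun w => lagrangian f A b w lambda)) => // w.
exact/differentiable_continuous/differentiable_lagrangian.
Qed.

End AugmentedLagrangian.

(** * Dual iterates and the rate estimates *)

Lemma dual_ascent_distance {R : realType} {m : nat} (rho : R)
    (a e : nat -> R) (lambda r : nat -> 'cV[R]_m) (mu : 'cV[R]_m) k :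
  (forall j, 0 <= a j <= rho) ->
  (forall j, lambda j.+1 = lambda j + a j *: r j) ->
  (forall j, inner (r j) (lambda j - mu) + rho * inner (r j) (r j) <= e j) ->
  enorm (lambda k - mu) ^+ 2 <=
  enorm (lambda 0%N - mu) ^+ 2 + 2 * \sum_(0 <= j < k) a j * e j.
Proof.
move=> a0rho lambdaS re; elim: k => [|k IH].
  by rewrite big_geq// mulr0 addr0.
rewrite big_nat_recr//= mulrDr addrA -lerBlDr; apply: le_trans IH.
rewrite lambdaS addrAC !sqr_enorm; have := re k; have /andP[a0 arho] := a0rho k.
move: (lambda k - mu) (r k) (e k) => d s t dst.
rewrite !innerE (innerC d s).
have := ler_wpM2l a0 dst.
(* The cross term 2a<s,d> contributes -2 a rho|s|^2, against a^2|s|^2 <= a rho|s|^2 from the square;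
   the surplus is dropped. *)
have : a k * (a k * inner s s) <= a k * (rho * inner s s).
  by rewrite ler_wpM2l// ler_wpM2r// inner_ge0.
have : 0 <= a k * (rho * inner s s).
  by rewrite !mulr_ge0 ?inner_ge0// (le_trans a0).
lra.
Qed.

Theorem theorem3p4 (R : realType) (m n : nat)
    (f : 'cV[R]_n -> R) (A : 'M[R]_(m, n)) (b : 'cV[R]_m) (Z : set 'cV[R]_n)
    (rho eps_in Lp Lund : R)
    (f_convex : convex_function [set: 'cV[R]_n] f)
    (f_diff : forall z : 'cV[R]_n, differentiable f z)
    (A_full_row_rank : row_free A)
    (Z_nonempty : Z !=set0)
    (Z_compact : compact Z)
    (Z_convex : convex_set Z)
    (rho_gt0 : 0 < rho)
    (eps_in_gt0 : 0 < eps_in)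
    (Lp_gt0 : 0 < Lp)
    (grad_lipschitz : forall (lambda : 'cV[R]_m) (z y : 'cV[R]_n),
       enorm (grad_aug_lagrangian f A b rho z lambda
              - grad_aug_lagrangian f A b rho y lambda) <= Lp * enorm (z - y))
    (slater_cq : slater A b Z)
    (lambda_star : 'cV[R]_m)
    (lambda_star_opt : dual_solution f A b Z lambda_star)
    (zbar : 'cV[R]_m -> 'cV[R]_n)
    (zbar_in_Z : forall lambda : 'cV[R]_m, Z (zbar lambda))
    (lambda_ : nat -> 'cV[R]_m) (alpha : nat -> R) :
  let Ld := 1 / rho in
  let Rp := diameter Z in
  let Rd := enorm (lambda_ 0%N - lambda_star) in
  let fstar := primal_value f A b Z in
  let delta := (1 + Num.sqrt (2 * Lp) * Rp) * eps_in in
  let S := fun k : nat => \sum_(0 <= j < k.+1) alpha j in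
  let zhat := fun k : nat =>
    (S k)^-1 *: \sum_(0 <= j < k.+1) alpha j *: zbar (lambda_ j) in
  let nu := fun k : nat =>
    2 * Lund * Rd / (k + 1)%:R + Num.sqrt (2 * Lund * delta / (k + 1)%:R) in
  Ld <= Lund ->
  (forall lambda : 'cV[R]_m,
     - delta <= min_over (fun z => inner
                  (grad_aug_lagrangian f A b rho (zbar lambda) lambda)
                  (z - zbar lambda)) Z) ->
  (forall k : nat, Lund^-1 <= alpha k <= Ld^-1) ->
  (forall k : nat, lambda_ k.+1 =
     lambda_ k + alpha k *: inexact_dual_grad A b zbar (lambda_ k)) ->
  forall k : nat, (1 <= k)%N ->
    - ((enorm lambda_star + rho / 2 * nu k) * nu k) <= f (zhat k) - fstar /\
    f (zhat k) - fstar
      <= Lund * enorm (lambda_ 0%N) ^+ 2 / (2 * (k + 1)%:R) + delta.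
Proof.
move=> Ld Rp Rd fstar delta S zhat nu Ld_le stat alphaP lambdaS k _.
have feasible : [set z | A *m z = b /\ Z z] !=set0.
  by case: slater_cq => z [Zz _] Az; exists z.
have Lund_gt0 : 0 < Lund by rewrite (lt_le_trans _ Ld_le)// divr_gt0.
have alpha_ge j : Lund^-1 <= alpha j by case/andP: (alphaP j).
have alpha_gt0 j : 0 < alpha j by rewrite (lt_le_trans _ (alpha_ge j))// invr_gt0.
have alpha_rho j : 0 <= alpha j <= rho.
  by rewrite ltW//=; case/andP: (alphaP j) => _; rewrite /Ld div1r invrK.
pose r j := A *m zbar (lambda_ j) - b.
have value j : f (zbar (lambda_ j)) + inner (r j) (lambda_ j)
    + rho * inner (r j) (r j) - delta <= fstar.
  have := stationarity_value_le f A b Z f_convex f_diff Z_compact feasible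
    _ _ _ _ (zbar_in_Z (lambda_ j)) (stat (lambda_ j)).
  by rewrite -/(r j) -/fstar innerDl innerZl (innerC (lambda_ j)) addrA.
have dual z : Z z -> fstar <= f z + inner lambda_star (A *m z - b).
  exact: dual_solution_lower_bound.
have S_gt0 : 0 < S k by exact: weight_sum_gt0.
have k_gt0 : 0 < (k + 1)%:R :> R by rewrite ltr0n addn1.
(* Each of the k + 1 steps is at least 1 / [Lund]; this is the source of the rate. *)
have S_ge : (k + 1)%:R / Lund <= S k.
  rewrite -[X in X%:R]subn0 addn1 mulr_natl -sumr_const_nat.
  exact: ler_sum.
have iS_le : (S k)^-1 <= Lund / (k + 1)%:R.
  by rewrite -[leRHS]invf_div lef_pV2 ?posrE// divr_gt0.
(* Testing stationarity of [zbar 0] against itself gives the sign without estimating the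
   diameter. *)
have delta_ge0 : 0 <= delta.
  have := approximate_stationarity f A b Z f_convex f_diff Z_compact
    _ _ _ _ (zbar_in_Z 0) (stat 0) _ (zbar_in_Z 0).
  lra.
split; last first.
  have := dual_ascent_distance rho alpha
    (fun j => fstar - f (zbar (lambda_ j)) + delta) lambda_ r 0 k.+1
    alpha_rho lambdaS.
  have e_le j : inner (r j) (lambda_ j - 0) + rho * inner (r j) (r j) <=
      fstar - f (zbar (lambda_ j)) + delta.
    by rewrite subr0; have := value j; lra.
  move/(_ e_le); rewrite !subr0.
  have -> : \sum_(0 <= j < k.+1) alpha j * (fstar - f (zbar (lambda_ j)) + delta)
      = S k * (fstar + delta) - \sum_(0 <= j < k.+1) alpha j * f (zbar (lambda_ j)).
    rewrite mulr_suml -sumrB; apply: eq_bigr => j _; ring.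
  have := convex_function_average alpha alpha_gt0 _ f (zbar \o lambda_) k f_convex.
  rewrite -[X in f X]/(zhat k) -[X in _ <= X]/((S k)^-1 * \sum_(0 <= j < k.+1) alpha j * f (zbar (lambda_ j))).
  rewrite ler_pdivlMl//; set T := \sum_(0 <= j < _) _.
  (* Dropping |lambda_(k+1)|^2 leaves |lambda_0|^2 / 2 to be divided by [S k]. *)
  have := sqr_ge0 (enorm (lambda_ k.+1)) => l0 fT lT.
  have fS : f (zhat k) - fstar - delta <= (S k)^-1 * (enorm (lambda_ 0%N) ^+ 2 / 2).
    by rewrite ler_pdivlMl//; lra.
  rewrite -lerBlDr (le_trans fS)//.
  rewrite (_ : Lund * _ / _ = Lund / (k + 1)%:R * (enorm (lambda_ 0%N) ^+ 2 / 2)).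
    by rewrite ler_wpM2r// divr_ge0 ?sqr_ge0.
  by field; rewrite gt_eqF.
have res_zhat : A *m zhat k - b = (S k)^-1 *: (lambda_ k.+1 - lambda_ 0%N).
  have -> : lambda_ k.+1 - lambda_ 0%N = \sum_(0 <= j < k.+1) alpha j *: r j.
    rewrite -telescope_sumr//; apply: eq_bigr => j _.
    by rewrite lambdaS addrAC subrr add0r.
  under eq_bigr do rewrite scalerBr scalemxAr.
  rewrite sumrB -mulmx_sumr -scaler_suml scalerBr scalerA mulVf ?gt_eqF//.
  by rewrite scale1r scalemxAr.
(* Adding [value] and [dual] at the same iterate cancels f(zbar_j) - f*, leaving the error
   [delta]. *)
have dist : enorm (lambda_ k.+1 - lambda_star) ^+ 2 <= Rd ^+ 2 + 2 * (S k * delta).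
  rewrite mulr_suml; apply: (dual_ascent_distance rho alpha (fun=> delta) _ r) => // j.
  rewrite innerDr innerNr (innerC _ lambda_star).
  by have := value j; have := dual _ (zbar_in_Z (lambda_ j)); rewrite -/(r j); lra.
have nu_ge : enorm (A *m zhat k - b) <= nu k.
  rewrite res_zhat enormZ; last by rewrite invr_ge0 ltW.
  have Rd0 : 0 <= Rd := enorm_ge0 _.
  have Sd0 : 0 <= 2 * (S k * delta).
    by rewrite mulr_ge0 ?(mulr_ge0 (ltW S_gt0) delta_ge0).
  have dist' : enorm (lambda_ k.+1 - lambda_star) <= Rd + Num.sqrt (2 * (S k * delta)).
    rewrite -ler_sqr ?nnegrE ?addr_ge0 ?enorm_ge0 ?sqrtr_ge0//.
    rewrite sqrrD (sqr_sqrtr Sd0).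
    have := mulr_ge0 Rd0 (sqrtr_ge0 (2 * (S k * delta))); lra.
  (* Passing through [lambda_star] costs a second [Rd], hence the factor 2 in [nu]. *)
  have tri : enorm (lambda_ k.+1 - lambda_ 0%N) <= 2 * Rd + Num.sqrt (2 * (S k * delta)).
    have := enormD (lambda_ k.+1 - lambda_star) (lambda_star - lambda_ 0%N).
    rewrite addrA subrK -[in X in _ <= _ + X -> _]enormN opprB -/Rd; lra.
  apply: (@le_trans _ _ ((S k)^-1 * (2 * Rd + Num.sqrt (2 * (S k * delta))))).
    by rewrite ler_wpM2l// invr_ge0 ltW.
  rewrite mulrDr lerD//.
    rewrite (_ : 2 * Lund * Rd / _ = Lund / (k + 1)%:R * (2 * Rd)).
      by rewrite ler_wpM2r// mulr_ge0.
    by field; rewrite gt_eqF.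
  have iS0 : 0 <= (S k)^-1 by rewrite invr_ge0 ltW.
  (* Moving 1/S_k under the root turns sqrt(2 S_k delta) / S_k into sqrt(2 delta / S_k). *)
  rewrite -[X in X * _](ger0_norm iS0) -sqrtr_sqr -sqrtrM ?sqr_ge0// ler_wsqrtr//.
  rewrite (_ : _ * _ = (S k)^-1 * (2 * delta)); last by field; rewrite gt_eqF.
  rewrite (_ : 2 * Lund * delta / _ = Lund / (k + 1)%:R * (2 * delta)).
    by rewrite ler_wpM2r// mulr_ge0.
  by field; rewrite gt_eqF.
have nu0 : 0 <= nu k := le_trans (enorm_ge0 _) nu_ge.
have Zzhat : Z (zhat k).
  by apply: (convex_set_average alpha alpha_gt0 _ Z (zbar \o lambda_)) => //= j.
(* Duality at [zhat k] and Cauchy-Schwarz give the bound -|lambda*| nu; subtracting the nonnegative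
   rho/2 nu^2 gives the stated form. *)
have := dual _ Zzhat; have := inner_le_enorm lambda_star (A *m zhat k - b).
have := ler_wpM2l (enorm_ge0 lambda_star) nu_ge.
have : 0 <= rho / 2 * nu k * nu k by rewrite !mulr_ge0// ltW.
lra.
Qed.
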